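(* Let $F_0$ be a field of characteristic not $2$. Let $(a,c)_{F_0}$ be a quaternion algebra over $F_0$ which remains a division algebra over the quadratic field extension $F=F_0(\sqrt b)$ of $F_0$ (that is, $(a,c)_{F_0}\otimes_{F_0}F$ is a division algebra), and let $(F_0(\sqrt b)/F_0,\tau,d)$ be a nonassociative quaternion algebra. Then the tensor product $$(a,c)_{F_0}\otimes_{F_0}(F_0(\sqrt b)/F_0,\tau,d)$$ is a division algebra over $F_0$.
   Context: Algebras are unital but not necessarily associative. A nonzero algebra $A$ is a division algebra if for every $x\ne0$ in $A$ the left and right multiplications by $x$ are bijective. $(a,c)_{F_0}$, $a,c\in F_0^\times$, is the (associative) quaternion algebra with $F_0$-basis $1,i,j,k=ij$, $i^2=a$, $j^2=c$, $ij=-ji$. Here $\tau$ is the nontrivial automorphism of $F/F_0$, $\tau(\sqrt b)=-\sqrt b$. For $d\in F\setminus F_0$, the nonassociative quaternion algebra $(F/F_0,\tau,d)$ is $F\oplus eF$ with multiplication $(x+ey)(x'+ey')=\big(xx'+d\,\tau(y)y'\big)+e\big(\tau(x)y'+yx'\big)$ for $x,y,x',y'\in F$. *)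

(* Defs.v *)
From HB Require Import structures.
From mathcomp Require Import all_boot all_order all_algebra all_field.
From mathcomp Require Import ring.

Set Implicit Arguments.
Unset Strict Implicit.
Unset Printing Implicit Defensive.

Import GRing.Theory.
Local Open Scope ring_scope.

(* Finite-dimensional, unital, not necessarily associative K-algebras. *)
Record naAlgebra (K : fieldType) := NAAlgebra {
  na_space :> vectType K;
  na_mul : na_space -> na_space -> na_space;
  na_one : na_space;
  na_mulr_linear : forall x, linear (na_mul x);
  na_mull_linear : forall y, linear (na_mul^~ y);
  na_mul1x : left_id na_one na_mul;
  na_mulx1 : right_id na_one na_mul
}.

Definition division_algebra (K : fieldType) (A : naAlgebra K) : Prop :=
  (exists x : A, x != 0) /\
  forall x : A, x != 0 ->
    bijective (fun y : A => na_mul x y) /\ bijective (fun y : A => na_mul y x).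

Section AssociativeAlgebra.
Variables (K : fieldType) (A : falgType K).

Fact falg_mulr_linear (x : A) : linear ( *%R x).
Proof. by move=> k u v; rewrite mulrDr scalerAr. Qed.

Fact falg_mull_linear (y : A) : linear ( *%R^~ y).
Proof. by move=> k u v; rewrite mulrDl scalerAl. Qed.

Definition naAlgebra_of_falg : naAlgebra K :=
  @NAAlgebra K A *%R 1 falg_mulr_linear falg_mull_linear (@mul1r A) (@mulr1 A).

End AssociativeAlgebra.

Section Quaternion.
Variables (K : fieldType) (a c : K).

(* (x0, x1, x2, x3) stands for x0 + x1 i + x2 j + x3 k. *)
Definition quat_space : vectType K := (K^o * K^o * K^o * K^o)%type.

Definition quat_mul (x y : quat_space) : quat_space :=
  let: (x0, x1, x2, x3) := x in
  let: (y0, y1, y2, y3) := y in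
  (x0 * y0 + a * x1 * y1 + c * x2 * y2 - a * c * x3 * y3,
   x0 * y1 + x1 * y0 - c * x2 * y3 + c * x3 * y2,
   x0 * y2 + x2 * y0 + a * x1 * y3 - a * x3 * y1,
   x0 * y3 + x3 * y0 + x1 * y2 - x2 * y1).

Definition quat_one : quat_space := (1, 0, 0, 0).
Definition quat_i : quat_space := (0, 1, 0, 0).
Definition quat_j : quat_space := (0, 0, 1, 0).
Definition quat_k : quat_space := (0, 0, 0, 1).

Let quat_eq (x0 x1 x2 x3 y0 y1 y2 y3 : K) :
  x0 = y0 -> x1 = y1 -> x2 = y2 -> x3 = y3 ->
  (x0, x1, x2, x3) = (y0, y1, y2, y3) :> quat_space.
Proof. by move=> -> -> -> ->. Qed.

Fact quat_mulr_linear x : linear (quat_mul x).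
Proof.
move: x => [[[x0 x1] x2] x3] k [[[u0 u1] u2] u3] [[[v0 v1] v2] v3].
by apply: quat_eq; rewrite /= /GRing.scale /=; ring.
Qed.

Fact quat_mull_linear y : linear (quat_mul^~ y).
Proof.
move: y => [[[y0 y1] y2] y3] k [[[u0 u1] u2] u3] [[[v0 v1] v2] v3].
by apply: quat_eq; rewrite /= /GRing.scale /=; ring.
Qed.

Fact quat_mul1x : left_id quat_one quat_mul.
Proof. by move=> [[[x0 x1] x2] x3]; apply: quat_eq; ring. Qed.

Fact quat_mulx1 : right_id quat_one quat_mul.
Proof. by move=> [[[x0 x1] x2] x3]; apply: quat_eq; ring. Qed.

Definition quaternion_algebra : naAlgebra K :=
  NAAlgebra quat_mulr_linear quat_mull_linear quat_mul1x quat_mulx1.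

Lemma quat_mulA : associative quat_mul.
Proof.
move=> [[[x0 x1] x2] x3] [[[y0 y1] y2] y3] [[[z0 z1] z2] z3].
by apply: quat_eq; ring.
Qed.

Lemma quat_mulii : quat_mul quat_i quat_i = a *: quat_one.
Proof. by apply: quat_eq; rewrite /= /GRing.scale /=; ring. Qed.

Lemma quat_muljj : quat_mul quat_j quat_j = c *: quat_one.
Proof. by apply: quat_eq; rewrite /= /GRing.scale /=; ring. Qed.

Lemma quat_mulij : quat_mul quat_i quat_j = quat_k.
Proof. by apply: quat_eq; ring. Qed.

Lemma quat_mulji : quat_mul quat_j quat_i = - quat_k.
Proof. by apply: quat_eq; rewrite /=; ring. Qed.

End Quaternion.

Section NonassociativeQuaternion.
Variables (F0 : fieldType) (F : fieldExtType F0).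
Variables (tau : {lrmorphism F -> F}) (d : F).

(* (x, y) stands for x + e y. *)
Definition naquat_space : vectType F0 := (F * F)%type.

Definition naquat_mul (u v : naquat_space) : naquat_space :=
  let: (x, y) := u in
  let: (x', y') := v in
  (x * x' + d * tau y * y', tau x * y' + y * x').

Definition naquat_one : naquat_space := (1, 0).

Let naquat_eq (x y x' y' : F) :
  x = x' -> y = y' -> (x, y) = (x', y') :> naquat_space.
Proof. by move=> -> ->. Qed.

Fact naquat_mulr_linear u : linear (naquat_mul u).
Proof.
move: u => [x y] k [u1 u2] [v1 v2].
apply: naquat_eq; rewrite /= !mulrDr -!scalerAr scalerDr; first exact: addrACA.
by rewrite addrACA.
Qed.

Fact naquat_mull_linear v : linear (naquat_mul^~ v).
Proof.
move: v => [x y] k [u1 u2] [v1 v2].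
apply: naquat_eq; rewrite /= linearP !(mulrDr, mulrDl) -!(scalerAr, scalerAl);
by rewrite scalerDr; exact: addrACA.
Qed.

Fact naquat_mul1x : left_id naquat_one naquat_mul.
Proof. by move=> [x y]; apply: naquat_eq; rewrite !(rmorph0, rmorph1); ring. Qed.

Fact naquat_mulx1 : right_id naquat_one naquat_mul.
Proof. by move=> [x y]; apply: naquat_eq; ring. Qed.

(* The construction makes sense for every tau and d; it is called a            *)
(* nonassociative quaternion algebra when F is a quadratic extension of F0,    *)
(* tau is its nontrivial automorphism and d lies outside F0.                   *)
Definition nonassoc_quaternion_algebra : naAlgebra F0 :=
  NAAlgebra naquat_mulr_linear naquat_mull_linear naquat_mul1x naquat_mulx1.

End NonassociativeQuaternion.

Section LinearFacts.
Variables (K : fieldType) (U V : lmodType K) (f : U -> V).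
Hypothesis lf : linear f.

Let fL : {linear U -> V} := HB.pack f (GRing.isLinear.Build K U V *:%R f lf).

Lemma linear_lincomb n (k : 'I_n -> K) (x : 'I_n -> U) :
  f (\sum_i k i *: x i) = \sum_i k i *: f (x i).
Proof.
rewrite -[f]/(fL : U -> V) linear_sum.
by apply: eq_bigr => i _; rewrite linearZ.
Qed.

End LinearFacts.

(* The tensor product of two finite-dimensional spaces is realised by matrices *)
(* of coordinates in the chosen bases vbasis; it has the universal property    *)
(* tensor_universal.                                                           *)
Section TensorSpace.
Variables (K : fieldType) (U V : vectType K).

Definition tensor_space : vectType K := 'M[K]_(\dim {:U}, \dim {:V}).

Definition tens (x : U) (y : V) : tensor_space :=
  \matrix_(i, j) (coord (vbasis {:U}) i x * coord (vbasis {:V}) j y).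

Lemma tensr_linear x : linear (tens x).
Proof.
by move=> k u v; apply/matrixP => i j; rewrite !mxE linearP /=; ring.
Qed.

Lemma tensl_linear y : linear (tens^~ y).
Proof.
by move=> k u v; apply/matrixP => i j; rewrite !mxE linearP /=; ring.
Qed.

Lemma tens_basis (i : 'I_(\dim {:U})) (j : 'I_(\dim {:V})) :
  tens (vbasis {:U})`_i (vbasis {:V})`_j = delta_mx i j.
Proof.
apply/matrixP => k l.
rewrite !mxE !coord_free ?(basis_free (vbasisP _)) // -natrM mulnb.
by rewrite (eq_sym k) (eq_sym l).
Qed.

Definition tens_lift (W : lmodType K) (f : U -> V -> W) (t : tensor_space) : W :=
  \sum_i \sum_j t i j *: f (vbasis {:U})`_i (vbasis {:V})`_j.

Lemma tens_lift_linear (W : lmodType K) (f : U -> V -> W) :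
  linear (tens_lift f).
Proof.
move=> k s t; rewrite /tens_lift scaler_sumr -big_split /=.
apply: eq_bigr => i _; rewrite scaler_sumr -big_split /=.
by apply: eq_bigr => j _; rewrite !mxE scalerDl scalerA.
Qed.

Lemma tens_lift_pure (W : lmodType K) (f : U -> V -> W) x y :
  (forall x, linear (f x)) -> (forall y, linear (f^~ y)) ->
  tens_lift f (tens x y) = f x y.
Proof.
move=> fr fl; rewrite {2}(coord_vbasis (memvf x)) (linear_lincomb (fl y)).
apply: eq_bigr => i _.
rewrite [in RHS](coord_vbasis (memvf y)) (linear_lincomb (fr _)) scaler_sumr.
by apply: eq_bigr => j _; rewrite mxE scalerA.
Qed.

Lemma tens_linear_ext (W : lmodType K) (g : tensor_space -> W) :
  linear g -> g =1 tens_lift (fun x y => g (tens x y)).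
Proof.
move=> lg t; pose gL : {linear tensor_space -> W} :=
  HB.pack g (GRing.isLinear.Build K tensor_space W *:%R g lg).
rewrite {1}[t]matrix_sum_delta -[LHS]/(gL _) linear_sum.
apply: eq_bigr => i _; rewrite linear_sum.
by apply: eq_bigr => j _; rewrite linearZ tens_basis.
Qed.

Lemma tensor_universal (W : lmodType K) (f : U -> V -> W) :
  (forall x, linear (f x)) -> (forall y, linear (f^~ y)) ->
  exists g : tensor_space -> W,
    [/\ linear g, forall x y, g (tens x y) = f x y &
        forall h : tensor_space -> W,
          linear h -> (forall x y, h (tens x y) = f x y) -> h =1 g].
Proof.
move=> fr fl; exists (tens_lift f); split=> [|x y|h lh hf t].
- exact: tens_lift_linear.
- exact: tens_lift_pure.
rewrite (tens_linear_ext lh); apply: eq_bigr => i _.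
by apply: eq_bigr => j _; rewrite hf.
Qed.

End TensorSpace.

Section TensorAlgebra.
Variables (K : fieldType) (A B : naAlgebra K).
Local Notation T := (tensor_space A B).

(* The bilinear extension of tens x y, tens x' y' |-> tens (x x') (y y'). *)
Definition tens_mul (u v : T) : T :=
  tens_lift (fun x y =>
    tens_lift (fun x' y' => tens (na_mul x x') (na_mul y y')) v) u.

Definition tens_one : T := tens (na_one A) (na_one B).

Let pure_r (x x' : A) (y : B) :
  linear (fun y' : B => tens (na_mul x x') (na_mul y y')).
Proof. by move=> k u v; rewrite na_mulr_linear tensr_linear. Qed.

Let pure_l (x : A) (y y' : B) :
  linear (fun x' : A => tens (na_mul x x') (na_mul y y')).
Proof. by move=> k u v; rewrite na_mulr_linear tensl_linear. Qed.

Let tens_liftD (f g h : A -> B -> T) (k : K) v :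
  (forall x y, f x y = k *: g x y + h x y) ->
  tens_lift f v = k *: tens_lift g v + tens_lift h v.
Proof.
move=> fE; rewrite /tens_lift scaler_sumr -big_split /=.
apply: eq_bigr => i _; rewrite scaler_sumr -big_split /=.
by apply: eq_bigr => j _; rewrite fE scalerDr !scalerA mulrC.
Qed.

Let outer_r v (x : A) : linear (fun y : B =>
  tens_lift (fun x' y' => tens (na_mul x x') (na_mul y y')) v).
Proof.
move=> k y1 y2; apply: tens_liftD => x' y'.
by rewrite na_mull_linear tensr_linear.
Qed.

Let outer_l v (y : B) : linear (fun x : A =>
  tens_lift (fun x' y' => tens (na_mul x x') (na_mul y y')) v).
Proof.
move=> k x1 x2; apply: tens_liftD => x' y'.
by rewrite na_mull_linear tensl_linear.
Qed.

Lemma tens_mulr_linear u : linear (tens_mul u).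
Proof.
by move=> k v w; apply: tens_liftD => x y; apply: tens_lift_linear.
Qed.

Lemma tens_mull_linear v : linear (tens_mul^~ v).
Proof. exact: tens_lift_linear. Qed.

Lemma tens_mul_pure x y x' y' :
  tens_mul (tens x y) (tens x' y') = tens (na_mul x x') (na_mul y y').
Proof.
rewrite /tens_mul tens_lift_pure; [|exact: outer_r|exact: outer_l].
by rewrite tens_lift_pure; [|move=> ?; exact: pure_r|move=> ?; exact: pure_l].
Qed.

Lemma tens_mul1x : left_id tens_one tens_mul.
Proof.
move=> u; rewrite (tens_linear_ext (tens_mulr_linear tens_one)).
rewrite [RHS](@tens_linear_ext _ _ _ _ id) //.
apply: eq_bigr => i _; apply: eq_bigr => j _.
by rewrite tens_mul_pure !na_mul1x.
Qed.

Lemma tens_mulx1 : right_id tens_one tens_mul.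
Proof.
move=> u; rewrite [LHS](tens_linear_ext (tens_mull_linear tens_one) u).
rewrite [RHS](@tens_linear_ext _ _ _ _ id) //.
apply: eq_bigr => i _; apply: eq_bigr => j _.
by rewrite tens_mul_pure !na_mulx1.
Qed.

Definition tensor_algebra : naAlgebra K :=
  NAAlgebra tens_mulr_linear tens_mull_linear tens_mul1x tens_mulx1.

End TensorAlgebra.

(* Main.v *)
Require Import Defs.
From mathcomp Require Import all_boot all_order all_algebra all_field.
From HB Require Import structures.

Set Implicit Arguments.
Unset Strict Implicit.
Unset Printing Implicit Defensive.

Import GRing.Theory.
Local Open Scope ring_scope.

(** Let D = (a,c) (x) F, an associative algebra which is a division algebra by
    hypothesis, and let sigma = id (x) tau, an involutive ring automorphism
    of D.  Splitting the second tensor factor F + eF gives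
    (a,c) (x) (F/F0, tau, d) = D + eD with the Cayley-Dickson style product
      (X + eY)(X' + eY') = (XX' + d sigma(Y) Y') + e(sigma(X) Y' + Y X'),
    d being identified with the central element 1 (x) d of D
    ([tensor_part1M], [tensor_part2M]).

    Suppose that this product vanishes and neither factor does
    ([twisted_double_no_zero_divisors]).  If Y = 0 then XX' = 0 and
    sigma(X) Y' = 0, which is impossible in the division ring D.  Otherwise
    X' = - Y^-1 sigma(X) Y', so Y' is nonzero, and cancelling it in the first
    component gives X Y^-1 sigma(X) = d sigma(Y).  Hence P = X Y^-1 satisfies
    P sigma(P) = d.  Applying sigma, sigma(P) P = sigma(d); comparing the two
    bracketings of P sigma(P) P and using that d is central yields
    P (sigma(d) - d) = 0.  As P = 0 would make d = 0, in every case
    sigma(d) = d, so tau(d) = d.  But in characteristic different from 2 the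
    fixed points of tau are the scalars, and d is not one.

    A finite-dimensional algebra without zero divisors is a division algebra,
    since injective endomorphisms are bijective.  The argument only sees (a,c)
    through associativity and through D being a division algebra, and is given
    in that generality ([tensor_nonassoc_division]). *)

(** * Division algebras of finite dimension *)

Section DivisionAlgebraBasics.
Variables (K : fieldType) (A : naAlgebra K).

Lemma na_mul0x (y : A) : na_mul 0 y = 0.
Proof.
by have := na_mull_linear y (-1) 0 0; rewrite scaleN1r addNr scaleN1r addNr.
Qed.

Lemma na_mulDl : left_distributive (@na_mul K A) +%R.
Proof. by move=> x y z; have := na_mull_linear z 1 x y; rewrite !scale1r. Qed.

Lemma na_mulDr : right_distributive (@na_mul K A) +%R.
Proof. by move=> x y z; have := na_mulr_linear x 1 y z; rewrite !scale1r. Qed.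

(** Rank-nullity. *)
Lemma linear_injective_bijective (f : A -> A) :
  linear f -> (forall x, f x = 0 -> x = 0) -> bijective f.
Proof.
move=> lf f_eq0.
pose fL : {linear A -> A} := HB.pack f (GRing.isLinear.Build K A A *:%R f lf).
have ker0 : lker (linfun fL) == 0%VS.
  apply/eqP/vspaceP => x; rewrite memv_ker memv0 lfunE /=.
  by apply/eqP/eqP=> [/f_eq0 //|->]; rewrite -[LHS]/(fL 0) raddf0.
exists ((linfun fL)^-1)%VF => x.
  by have := lker0_lfunK ker0 x; rewrite lfunE.
by have := lker0_lfunVK ker0 x; rewrite lfunE.
Qed.

Lemma no_zero_divisors_division_algebra :
  (exists x : A, x != 0) ->
  (forall x y : A, na_mul x y = 0 -> x = 0 \/ y = 0) ->
  division_algebra A.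
Proof.
move=> A_neq0 no0; split=> // x /eqP x0; split.
  apply: linear_injective_bijective; first exact: na_mulr_linear.
  by move=> y /no0[].
apply: linear_injective_bijective; first exact: na_mull_linear.
by move=> y /no0[].
Qed.

(** Surjectivity of the left multiplication by x gives a right inverse y;
    then x (y x) = x, so injectivity makes y a left inverse as well. *)
Lemma division_algebra_inverse : associative (@na_mul K A) ->
  division_algebra A ->
  forall x : A, x != 0 ->
  exists y, na_mul x y = na_one A /\ na_mul y x = na_one A.
Proof.
move=> mulA [_ divA] x /divA[[g gK Kg] _]; exists (g (na_one A)).
split; first exact: Kg.
by apply: (can_inj gK); rewrite mulA Kg na_mul1x na_mulx1.
Qed.

End DivisionAlgebraBasics.

(** * Twisted doubling of a division ring *)

(** The two hypotheses on x, y, x', y' say that (x + ey)(x' + ey') = 0.  For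
    nonzero factors y is invertible, and p = x y^-1 is a solution of
    p sigma(p) = d, which forces d to be fixed by sigma because d is central. *)
Lemma twisted_double_no_zero_divisors (R : pzRingType)
    (sigma : {rmorphism R -> R}) (d : R) :
  involutive sigma -> (forall x, d * x = x * d) -> sigma d != d ->
  (forall x : R, x != 0 -> exists y, x * y = 1 /\ y * x = 1) ->
  forall x y x' y' : R,
    x * x' + d * sigma y * y' = 0 -> sigma x * y' + y * x' = 0 ->
    x = 0 /\ y = 0 \/ x' = 0 /\ y' = 0.
Proof.
move=> sigmaK dC sd_neq_d inv x y x' y' e1 e2.
have mulf0l : forall u v : R, u * v = 0 -> u != 0 -> v = 0.
  by move=> u v uv0 /inv[w [_ wu]]; rewrite -[v]mul1r -wu -mulrA uv0 mulr0.
have mulf0r : forall u v : R, u * v = 0 -> v != 0 -> u = 0.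
  by move=> u v uv0 /inv[w [vw _]]; rewrite -[u]mulr1 -vw mulrA uv0 mul0r.
have [y0|y_neq0] := eqVneq y 0.
  have [x0|x_neq0] := eqVneq x 0; first by left.
  rewrite y0 rmorph0 mulr0 !mul0r !addr0 in e1 e2.
  right; split; first exact: mulf0l e1 x_neq0.
  by apply: mulf0l e2 _; rewrite -(rmorph0 sigma) (can_eq sigmaK).
have [w [yw wy]] := inv y y_neq0.
have x'E : x' = - (w * sigma x * y').
  have yx' : y * x' = - (sigma x * y').
    by apply/eqP; rewrite -addr_eq0 addrC e2.
  by rewrite -[x']mul1r -wy -mulrA yx' mulrN mulrA.
have [y'0|y'_neq0] := eqVneq y' 0.
  by right; rewrite x'E y'0 mulr0 oppr0.
case/negP: sd_neq_d.
(* Substitute x' in the first equation and cancel y' on the right. *)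
have xwx : x * w * sigma x = d * sigma y.
  apply/esym/eqP; rewrite -subr_eq0; apply/eqP.
  apply: mulf0r y'_neq0; rewrite mulrBl -[RHS]e1 x'E mulrN addrC.
  by rewrite !mulrA.
pose p := x * w.
have p_sp : p * sigma p = d.
  by rewrite rmorphM mulrA xwx -mulrA -rmorphM yw rmorph1 mulr1.
have sp_p : sigma p * p = sigma d by rewrite -p_sp rmorphM sigmaK.
(* p sigma(d) = p sigma(p) p = d p = p d. *)
rewrite -subr_eq0; apply/eqP.
have [p0|p_neq0] := eqVneq p 0; first by rewrite -p_sp p0 mul0r rmorph0 subrr.
apply: mulf0l p_neq0.
by rewrite mulrBr -sp_p mulrA p_sp dC subrr.
Qed.

(** * Linear maps on tensor products *)

Section TensorMaps.
Variables (K : fieldType) (U V V' : vectType K).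

Lemma tensDr (x : U) (y y' : V) : tens x (y + y') = tens x y + tens x y'.
Proof. by have := tensr_linear x 1 y y'; rewrite !scale1r. Qed.

Lemma tensZl k (x : U) (y : V) : tens (k *: x) y = k *: tens x y.
Proof.
by apply/matrixP => i j; rewrite !mxE linearZ /= mulrA.
Qed.

Lemma tensx0 (x : U) : tens x 0 = 0 :> tensor_space U V.
Proof. by apply/matrixP => i j; rewrite !mxE linear0 mulr0. Qed.

(** Closure under addition suffices, because the scalar of a term k (x (x) y)
    can be absorbed into x.  Multilinear identities between tensors are thus
    reduced to pure tensors using additivity alone. *)
Lemma tens_ind (P : tensor_space U V -> Prop) :
  (forall u v, P u -> P v -> P (u + v)) -> (forall x y, P (tens x y)) ->
  forall u, P u.
Proof.
move=> PD Ptens u; have P0 : P 0 by rewrite -(tensx0 0).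
rewrite [u](@tens_linear_ext _ _ _ _ id) //.
apply: big_ind => // i _; apply: big_ind => // j _.
by rewrite -tensZl.
Qed.

(** The map id (x) g. *)
Definition tens_mapr (g : V -> V') : tensor_space U V -> tensor_space U V' :=
  tens_lift (fun x y => tens x (g y)).

Lemma tens_mapr_pure g x y : linear g -> tens_mapr g (tens x y) = tens x (g y).
Proof.
move=> lg; rewrite /tens_mapr tens_lift_pure // => [{}x|{}y] k u v.
  by rewrite lg tensr_linear.
exact: tensl_linear.
Qed.

Lemma tens_maprD g u v : tens_mapr g (u + v) = tens_mapr g u + tens_mapr g v.
Proof.
have := tens_lift_linear (fun x y => tens x (g y)) 1 u v.
by rewrite !scale1r.
Qed.

End TensorMaps.

(** Some coordinate of x is nonzero; the corresponding row of x (x) y is a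
    nonzero multiple of the coordinate vector of y. *)
Lemma tens_injr (K : fieldType) (U V : vectType K) (x : U) :
  x != 0 -> injective (fun y : V => tens x y).
Proof.
move=> x_neq0 y y' /matrixP eq_yy'.
have [i xi_neq0] : exists i, coord (vbasis {:U}) i x != 0.
  apply/existsP; apply: contraNT x_neq0; rewrite negb_exists => /forallP xi0.
  rewrite (coord_vbasis (memvf x)) big1 // => i _.
  by move/negPn/eqP: (xi0 i) => ->; rewrite scale0r.
rewrite (coord_vbasis (memvf y)) (coord_vbasis (memvf y')).
apply: eq_bigr => j _; congr (_ *: _).
by apply: (mulfI xi_neq0); have := eq_yy' i j; rewrite !mxE.
Qed.

(** * The associative algebra A (x) F and its twist *)

Section TensorRing.
Variables (K : fieldType) (A : naAlgebra K) (F : fieldExtType K).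
Hypothesis mulA : associative (@na_mul K A).

Local Notation AF := (tensor_algebra A (naAlgebra_of_falg F)).

Lemma tensor_algebra_mulA : associative (@na_mul K AF).
Proof.
elim/tens_ind=> [u u' IHu IHu' v w|x1 y1]; first by rewrite !na_mulDl IHu IHu'.
elim/tens_ind=> [v v' IHv IHv' w|x2 y2].
  by rewrite na_mulDl !na_mulDr na_mulDl IHv IHv'.
elim/tens_ind=> [w w' IHw IHw'|x3 y3]; first by rewrite !na_mulDr IHw IHw'.
by rewrite /= !tens_mul_pure mulA /= mulrA.
Qed.

(** The algebra A (x) F as a type carrying a ring structure; the associativity
    proof is a parameter of the type so that the structure can be inferred. *)
Definition tensor_ring of associative (@na_mul K A) : Type := AF.
Local Notation R := (tensor_ring mulA).

HB.instance Definition _ := GRing.Zmodule.on R.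
HB.instance Definition _ := GRing.Zmodule_isPzRing.Build R
  tensor_algebra_mulA (@na_mul1x K AF) (@na_mulx1 K AF)
  (@na_mulDl K AF) (@na_mulDr K AF).

Lemma tensM x y x' y' :
  (tens x y : R) * (tens x' y' : R) = tens (na_mul x x') (y * y') :> R.
Proof. exact: tens_mul_pure. Qed.

Lemma tensor_ring_central (z : F) (u : R) :
  (tens (na_one A) z : R) * u = u * (tens (na_one A) z : R).
Proof.
move: u; apply: tens_ind => [u v IHu IHv|x y].
  by rewrite (mulrDl (u : R)) (mulrDr _ (u : R)) IHu IHv.
by rewrite !tensM na_mul1x na_mulx1 mulrC.
Qed.

Variable tau : {lrmorphism F -> F}.

(** The automorphism id (x) tau, called sigma above. *)
Definition tensor_twist : R -> R := tens_mapr tau.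

Lemma tensor_twistE x y : tensor_twist (tens x y) = tens x (tau y).
Proof. by apply: tens_mapr_pure; exact: linearP. Qed.

Lemma tensor_twistD (u v : R) :
  tensor_twist (u + v) = tensor_twist u + tensor_twist v.
Proof. exact: tens_maprD. Qed.

Lemma tensor_twist0 : tensor_twist 0 = 0.
Proof.
by apply: (addrI (tensor_twist 0)); rewrite -tensor_twistD !addr0.
Qed.

Lemma tensor_twist_monoid_morphism : monoid_morphism tensor_twist.
Proof.
split; first by rewrite /= tensor_twistE rmorph1.
apply: tens_ind => [u u' IHu IHu' v|x y].
  by rewrite (mulrDl (u : R)) !tensor_twistD mulrDl IHu IHu'.
apply: tens_ind => [v v' IHv IHv'|x' y'].
  by rewrite (mulrDr _ (v : R)) !tensor_twistD mulrDr IHv IHv'.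
by rewrite tensM !tensor_twistE tensM rmorphM.
Qed.

HB.instance Definition _ :=
  GRing.isNmodMorphism.Build R R tensor_twist
    (conj tensor_twist0 tensor_twistD).
HB.instance Definition _ :=
  GRing.isMonoidMorphism.Build R R tensor_twist tensor_twist_monoid_morphism.

Lemma tensor_twistK : involutive tau -> involutive tensor_twist.
Proof.
move=> tauK; apply: tens_ind => [u v IHu IHv|x y].
  by rewrite !tensor_twistD IHu IHv.
by rewrite !tensor_twistE tauK.
Qed.

(** * The decomposition A (x) (F + eF) = D + eD *)

Variable d : F.
Local Notation T := (tensor_algebra A (nonassoc_quaternion_algebra tau d)).

(** The projections and injections of the decomposition T = D + eD, where
    D = A (x) F; part 1 is the component in D and part 2 the one in eD. *)
Definition tensor_part1 : T -> R := tens_mapr (fun z : naquat_space F => z.1).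
Definition tensor_part2 : T -> R := tens_mapr (fun z : naquat_space F => z.2).
Definition tensor_incl1 : R -> T :=
  tens_mapr (fun x => (x, 0) : naquat_space F).
Definition tensor_incl2 : R -> T :=
  tens_mapr (fun y => (0, y) : naquat_space F).

Lemma tensor_part1E x z : tensor_part1 (tens x z) = tens x z.1.
Proof. exact: tens_mapr_pure. Qed.

Lemma tensor_part2E x z : tensor_part2 (tens x z) = tens x z.2.
Proof. exact: tens_mapr_pure. Qed.

Lemma tensor_part1D u v :
  tensor_part1 (u + v) = tensor_part1 u + tensor_part1 v.
Proof. exact: tens_maprD. Qed.

Lemma tensor_part2D u v :
  tensor_part2 (u + v) = tensor_part2 u + tensor_part2 v.
Proof. exact: tens_maprD. Qed.

Lemma tensor_incl1E x y : tensor_incl1 (tens x y) = tens x (y, 0).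
Proof.
apply: tens_mapr_pure => k u v.
by rewrite /GRing.scale /= /GRing.add /= /add_pair /= scaler0 addr0.
Qed.

Lemma tensor_incl2E x y : tensor_incl2 (tens x y) = tens x (0, y).
Proof.
apply: tens_mapr_pure => k u v.
by rewrite /GRing.scale /= /GRing.add /= /add_pair /= scaler0 addr0.
Qed.

Lemma tensor_partK u :
  tensor_incl1 (tensor_part1 u) + tensor_incl2 (tensor_part2 u) = u.
Proof.
elim/tens_ind: u => [u v IHu IHv|x [y1 y2]].
  by rewrite tensor_part1D tensor_part2D /tensor_incl1 /tensor_incl2
     !tens_maprD addrACA IHu IHv.
rewrite tensor_part1E tensor_part2E tensor_incl1E tensor_incl2E -tensDr.
by congr tens; congr pair; rewrite /= ?addr0 ?add0r.
Qed.

Lemma tensor_parts_eq0 u : tensor_part1 u = 0 -> tensor_part2 u = 0 -> u = 0.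
Proof.
move=> u1 u2; rewrite -[u]tensor_partK u1 u2 -[0 : R](tensx0 _ 0).
by rewrite tensor_incl1E tensor_incl2E !tensx0 addr0.
Qed.

(** Together with [tensor_part2M], the product of (F/F0, tau, d) extended from
    F to A (x) F: by additivity in each argument it is enough to compare pure
    tensors, where it is the definition of that product. *)
Lemma tensor_part1M u v : tensor_part1 (na_mul u v) =
  tensor_part1 u * tensor_part1 v
  + (tens (na_one A) d : R) * tensor_twist (tensor_part2 u) * tensor_part2 v.
Proof.
elim/tens_ind: u v => [u u' IHu IHu' v|x [y1 y2]].
  rewrite na_mulDl !tensor_part1D !tensor_part2D tensor_twistD IHu IHu'.
  by rewrite mulrDr !mulrDl addrACA.
elim/tens_ind=> [v v' IHv IHv'|x' [y1' y2']].
  by rewrite na_mulDr !tensor_part1D !tensor_part2D IHv IHv' !mulrDr addrACA.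
rewrite /= tens_mul_pure !tensor_part1E !tensor_part2E tensor_twistE !tensM /=.
by rewrite na_mul1x tensDr.
Qed.

Lemma tensor_part2M u v : tensor_part2 (na_mul u v) =
  tensor_twist (tensor_part1 u) * tensor_part2 v
  + tensor_part2 u * tensor_part1 v.
Proof.
elim/tens_ind: u v => [u u' IHu IHu' v|x [y1 y2]].
  rewrite na_mulDl !tensor_part1D !tensor_part2D tensor_twistD IHu IHu'.
  by rewrite !mulrDl addrACA.
elim/tens_ind=> [v v' IHv IHv'|x' [y1' y2']].
  by rewrite na_mulDr !tensor_part1D !tensor_part2D IHv IHv' !mulrDr addrACA.
rewrite /= tens_mul_pure !tensor_part1E !tensor_part2E tensor_twistE !tensM /=.
by rewrite tensDr.
Qed.

(** Injectivity of z |-> 1 (x) z carries tau(d) <> d over to the central element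
    1 (x) d, so that the doubling argument applies to A (x) F. *)
Lemma tensor_nonassoc_division : involutive tau -> tau d != d ->
  division_algebra AF -> division_algebra T.
Proof.
move=> tauK td_neq_d divAF.
have oneAF : na_one AF != 0.
  case: divAF => [[x x_neq0] _]; apply: contra x_neq0 => /eqP one0.
  by rewrite -[x]na_mul1x one0 na_mul0x.
have one_neq0 : na_one A != 0.
  apply: contra oneAF => /eqP one0.
  rewrite /= /tens_one one0; apply/eqP/matrixP => i j.
  by rewrite !mxE linear0 mul0r.
apply: no_zero_divisors_division_algebra.
  exists (tens (na_one A) (na_one (nonassoc_quaternion_algebra tau d))).
  apply/eqP; rewrite -[RHS](tensx0 _ (na_one A)) => /(tens_injr one_neq0)[].
  by apply/eqP; exact: oner_neq0.
move=> u v uv0.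
have part0 : tensor_part1 0 = 0 /\ tensor_part2 0 = 0.
  by rewrite -(tensx0 _ 0) tensor_part1E tensor_part2E /= tensx0.
have twist_d : tensor_twist (tens (na_one A) d : R) != tens (na_one A) d.
  by rewrite tensor_twistE (inj_eq (tens_injr one_neq0)).
have := @twisted_double_no_zero_divisors R tensor_twist (tens (na_one A) d)
  (tensor_twistK tauK) (tensor_ring_central d) twist_d
  (division_algebra_inverse tensor_algebra_mulA divAF)
  (tensor_part1 u) (tensor_part2 u) (tensor_part1 v) (tensor_part2 v).
rewrite -tensor_part1M -tensor_part2M uv0.
case: part0 => -> -> /(_ erefl erefl)[[u1 u2]|[v1 v2]].
  by left; exact: tensor_parts_eq0.
by right; exact: tensor_parts_eq0.
Qed.

End TensorRing.

(** * Coordinates in a quadratic extension *)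

(** Every element of K(s) is a polynomial in s of degree less than the degree
    of the extension, which is 2. *)
Lemma quadratic_decomposition (K : fieldType) (F : fieldExtType K) (s : F) :
  <<1; s>>%VS = {:F}%VS -> \dim {:F} = 2%N ->
  forall x : F, exists p q : K, x = p%:A + q *: s.
Proof.
move=> F_gen F_quad x.
have sizep : (size (Fadjoin_poly 1%VS s x) <= 2)%N.
  apply: leq_trans (size_Fadjoin_poly _ _ _) _.
  by rewrite adjoin_degreeE F_gen F_quad dimv1.
have /polyOver1P[f fE] := Fadjoin_polyOver 1%VS s x.
exists f`_0, f`_1.
have xF : x \in <<1; s>>%VS by rewrite F_gen memvf.
rewrite -[LHS](Fadjoin_poly_eq xF) (horner_coef_wide _ sizep).
by rewrite fE !big_ord_recl big_ord0 !coef_map /= addr0 mulr1 mulr_algl.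
Qed.

Theorem theorem17 (F0 : fieldType) (char_neq2 : 2%N \notin [pchar F0])
    (a c : F0) (a_neq0 : a != 0) (c_neq0 : c != 0)
    (F : fieldExtType F0) (b : F0) (sqrtb : F)
    (sqrtbK : sqrtb ^+ 2 = b%:A)
    (F_gen : <<1; sqrtb>>%VS = {:F}%VS)
    (F_quadratic : \dim {:F} = 2%N)
    (quat_division :
       division_algebra
         (tensor_algebra (quaternion_algebra a c) (naAlgebra_of_falg F)))
    (tau : {lrmorphism F -> F}) (tau_sqrtb : tau sqrtb = - sqrtb)
    (d : F) (d_notin_F0 : d \notin 1%VS) :
  division_algebra
    (tensor_algebra (quaternion_algebra a c)
                    (nonassoc_quaternion_algebra tau d)).
Proof.
have decomp := quadratic_decomposition F_gen F_quadratic.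
have tauE p q : tau (p%:A + q *: sqrtb) = p%:A - q *: sqrtb.
  by rewrite linearP linearZ /= rmorph1 tau_sqrtb scalerN addrC.
apply: (@tensor_nonassoc_division _ (quaternion_algebra a c) F
          (@quat_mulA _ a c)) => //.
  move=> x; have [p [q ->]] := decomp x.
  by rewrite tauE -scaleNr tauE scaleNr opprK.
(* If tau fixes d = p + q sqrtb, then 2 q sqrtb = 0, so d = p. *)
apply: contra d_notin_F0; have [p [q ->]] := decomp d.
rewrite tauE (inj_eq (addrI _)) eq_sym -subr_eq0 opprK -mulr2n -scaler_nat.
rewrite scaler_eq0 => /orP[/eqP two0|/eqP->].
  by case/negP: char_neq2; rewrite inE /= two0.
by rewrite addr0; apply/vlineP; exists p.
Qed.
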